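(* For every $\epsilon>0$ there exists an integer $N$ such that for all $n\geq N$, $$\Delta_n\geq\frac{1-\epsilon}{2^n\sum_{k=1}^\infty e^{-k^2\pi}}.$$ (Here $1/\sum_{k\geq1}e^{-k^2\pi}\approx 23.1388$.)
   Context: $\Delta_n$ denotes the maximal density of $n$-dimensional lattice packings: the supremum over lattices $\Lambda\subset\mathbf{E}^n$ of $\Delta(\Lambda)=\sqrt{(\min\Lambda)^n/(4^n\det\Lambda)}\,V_n$, where $\min\Lambda$ is the squared length of a shortest nonzero vector, $\det\Lambda$ the Gram determinant, and $V_n=\pi^{n/2}/(n/2)!$ the volume of the unit $n$-ball. *)

(* Defs.v *)
From HB Require Import structures.
From mathcomp Require Import all_boot all_order all_algebra.
From mathcomp Require Import all_classical all_reals all_analysis.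

Set Implicit Arguments.
Unset Strict Implicit.
Unset Printing Implicit Defensive.

Import Order.TTheory GRing.Theory Num.Theory.
Import numFieldNormedType.Exports.

Local Open Scope classical_set_scope.
Local Open Scope ring_scope.

(* The Euclidean squared length; the library norm `|x| on 'rV_n is the
   sup-norm. *)
Definition sqnorm (R : realType) (n : nat) (x : 'rV[R]_n) : R :=
  \sum_(i < n) x 0 i ^+ 2.

(* The rows of B form a Z-basis of L and an R-basis of E^n = 'rV[R]_n. *)
Definition is_lattice_basis (R : realType) (n : nat) (L : set 'rV[R]_n)
    (B : 'M[R]_n) : Prop :=
  B \in unitmx /\
  L = [set x | exists z : 'rV[int]_n, x = map_mx intr z *m B].

Definition is_lattice (R : realType) (n : nat) (L : set 'rV[R]_n) : Prop :=
  exists B : 'M[R]_n, is_lattice_basis L B.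

(* For n > 0 and L a lattice the infimum is attained, L being discrete. *)
Definition lattice_min (R : realType) (n : nat) (L : set 'rV[R]_n) : R :=
  inf [set sqnorm x | x in L `\ 0].

(* The Gram determinant of a chosen basis; lattice_detE shows that the choice
   does not matter. *)
Definition lattice_det (R : realType) (n : nat) (L : set 'rV[R]_n) : R :=
  let B := xget 0 [set B : 'M[R]_n | is_lattice_basis L B] in
  \det (B *m B^T).

(* The factorial x! = Gamma(x + 1) of a real number x > -1. *)
Definition real_fact (R : realType) (x : R) : R :=
  \int[lebesgue_measure]_(t in `[0, +oo[) (t `^ x * expR (- t)).

Definition ball_volume (R : realType) (n : nat) : R :=
  pi `^ (n%:R / 2) / real_fact (n%:R / 2).

Definition density (R : realType) (n : nat) (L : set 'rV[R]_n) : R :=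
  Num.sqrt (lattice_min L ^+ n / (4 ^+ n * lattice_det L)) * ball_volume R n.

(* The supremum is taken in the extended reals, where it always exists, rather
   than with the real-valued sup, which is 0 on unbounded sets. *)
Definition max_density (R : realType) (n : nat) : \bar R :=
  ereal_sup [set (density L)%:E | L in [set L : set 'rV[R]_n | is_lattice L]].

Lemma lattice_basis_change (R : realType) (n : nat) (L : set 'rV[R]_n)
    (B C : 'M[R]_n) :
  is_lattice_basis L B -> is_lattice_basis L C ->
  exists P : 'M[int]_n, C = map_mx intr P *m B.
Proof.
move=> [_ LB] [_ LC].
have rowP (i : 'I_n) : exists z : 'rV[int]_n, row i C = map_mx intr z *m B.
  suff : L (row i C) by rewrite LB.
  by rewrite LC /=; exists (delta_mx 0 i); rewrite map_delta_mx rowE.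
have [f fP] := choice rowP.
exists (\matrix_i f i); apply/row_matrixP => i.
by rewrite fP row_mul -map_row rowK.
Qed.

Lemma lattice_detE (R : realType) (n : nat) (L : set 'rV[R]_n) (B : 'M[R]_n) :
  is_lattice_basis L B -> lattice_det L = \det (B *m B^T).
Proof.
move=> LB; rewrite /lattice_det; case: xgetP => [C _ /= LC|/(_ B)//].
have [P CE] := lattice_basis_change LB LC.
have [Q BE] := lattice_basis_change LC LB.
have detC : \det C = (\det P)%:~R * \det B by rewrite {1}CE det_mulmx det_map_mx.
have detB : \det B = (\det Q)%:~R * \det C by rewrite {1}BE det_mulmx det_map_mx.
have B0 : \det B != 0 by case: LB; rewrite unitmxE unitfE.
have QP : \det Q * \det P = 1.
  apply: (@intr_inj R); rewrite intrM.
  by apply: (mulIf B0); rewrite mul1r -mulrA -detC -detB.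
have P2 : \det P ^+ 2 = 1.
  move/(congr1 absz)/eqP: QP; rewrite abszM muln_eq1 => /andP[_ /eqP P1].
  by rewrite -real_normK ?num_real// -abszE P1.
rewrite !det_mulmx !det_tr detC mulrACA -intrM -expr2 P2.
by rewrite mul1r.
Qed.

(* Main.v *)
(* A Rogers-type argument, which gives more than asked: 2^n Delta_n tends to
   infinity, so the value of the theta constant is irrelevant.

   For a prime p, average the Gaussian sum of e^(-b |x|^2) over the nonzero
   points x of the lattices {x : x = x_0 (1, a) mod p}, of determinant p^(n-1):
   some lattice L has a sum of at most about p^-(n-1) (pi / b)^(n/2).  Choose b
   so that this is n e^(-n/2).  Applied to linearly independent vectors of L
   realizing the successive minima l_1 <= ... <= l_n, the bound implies
   prod (b l_i^2) >= e^-8 (n/2)^n, because ln (c / v) <= 4 e^(c - v) / c for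
   v >= 1.  Dividing the i-th coordinate by l_i, in an orthonormal basis adapted
   to the flag spanned by these vectors, turns L into a lattice of minimum at
   least 1 and covolume p^(n-1) / prod l_i, hence of density at least
   const 2^-n n (n / 2e)^(n/2) / (n/2)!.  This is large compared with 2^-n since
   x! = o(x (x / e)^x), which follows from
   t^x e^-t <= (x / e)^x e^(-(sqrt t - sqrt x)^2). *)
Require Import Defs.
From HB Require Import structures.
From mathcomp Require Import all_boot all_order all_algebra.
From mathcomp Require Import all_classical all_reals all_analysis.
From mathcomp Require Import measurable_realfun.
From mathcomp Require Import ring lra zify.

Set Implicit Arguments.
Unset Strict Implicit.
Unset Printing Implicit Defensive.

Import Order.TTheory GRing.Theory Num.Theory.
Import numFieldNormedType.Exports.

Local Open Scope classical_set_scope.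
Local Open Scope ring_scope.

(** * The factorial *)

(* Uses [ln u = 2 ln (sqrt u) <= 2 (sqrt u - 1)] at [u = t / x]. *)
Lemma powR_expRN_le (R : realType) (x t : R) : 0 < x -> 0 <= t ->
  t `^ x * expR (- t) <=
    expR (x * ln x - x) * expR (- (Num.sqrt t - Num.sqrt x) ^+ 2).
Proof.
move=> x0; rewrite le_eqVlt => /predU1P[<-|t0].
  by rewrite powR0 ?gt_eqF// mul0r mulr_ge0// expR_ge0.
rewrite /powR gt_eqF// -!expRD ler_expR.
have st : 0 < Num.sqrt t by rewrite sqrtr_gt0.
have sx : 0 < Num.sqrt x by rewrite sqrtr_gt0.
have lt2 : ln t = 2 * ln (Num.sqrt t).
  by rewrite -{1}(sqr_sqrtr (ltW t0)) lnXn// mulr_natl.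
have lx2 : ln x = 2 * ln (Num.sqrt x).
  by rewrite -{1}(sqr_sqrtr (ltW x0)) lnXn// mulr_natl.
have h : ln (Num.sqrt t) - ln (Num.sqrt x) <= Num.sqrt t / Num.sqrt x - 1.
  rewrite -ln_div// ?posrE//.
  have := @le_ln1Dx R (Num.sqrt t / Num.sqrt x - 1); rewrite addrCA subrr addr0; apply.
  by rewrite ltrBrDl subrr divr_gt0.
have := ler_wpM2l (ltW x0) h; rewrite lt2 lx2.
rewrite [leRHS](_ : _ = Num.sqrt t * Num.sqrt x - x); last first.
  by rewrite mulrBr mulr1 -{1}(sqr_sqrtr (ltW x0)); field; exact: lt0r_neq0.
have := sqr_sqrtr (ltW x0); have := sqr_sqrtr (ltW t0).
move: (Num.sqrt t) (Num.sqrt x) => a b ha hb; nra.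
Qed.

Lemma expRN_le_inv (R : realType) (y : R) : 0 < y -> expR (- y) <= y^-1.
Proof.
move=> y0; rewrite expRN lef_pV2 ?posrE ?expR_gt0//.
by apply: le_trans (expR_ge1Dx y); rewrite lerDr.
Qed.

(* The exponent is [(t - x)^2 / (sqrt t + sqrt x)^2], which is at least
   [d^2 x / 9] when [d x <= |t - x|] and [t <= 4 x], and at least [t / 4] beyond. *)
Lemma expRN_sqrt_sub_le (R : realType) (d x t : R) : 0 < d -> 0 < x -> 0 <= t ->
  expR (- (Num.sqrt t - Num.sqrt x) ^+ 2) <=
    \1_(`[x - d * x, x + d * x]) t + 9 / (d ^+ 2 * x) * \1_(`[0, 4 * x]) t
    + 4 * exponential_pdf 4^-1 t.
Proof.
move=> d0 x0 t0.
have q0 : 0 <= 9 / (d ^+ 2 * x) :> R.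
  by rewrite divr_ge0// mulr_ge0// ?ltW// exprn_gt0.
have i0 (A : set R) : 0 <= \1_A t :> R by rewrite indicE.
have p0 : 0 <= 4 * exponential_pdf 4^-1 t :> R.
  by rewrite mulr_ge0// exponential_pdf_ge0.
have st : 0 <= Num.sqrt t by exact: sqrtr_ge0.
have sx : 0 < Num.sqrt x by rewrite sqrtr_gt0.
have := sqr_sqrtr (ltW x0); have := sqr_sqrtr t0 => ht hx.
have [h1|/negP h1] := pselect (t \in `[x - d * x, x + d * x]).
  rewrite indicE mem_set//=.
  apply: (@le_trans _ _ 1).
    by rewrite -expR0 ler_expR oppr_le0 sqr_ge0.
  by rewrite -addrA lerDl addr_ge0// mulr_ge0.
have [h4|h4] := lerP t (4 * x).
  rewrite [X in _ <= _ + _ * X + _]indicE mem_set/=; last by rewrite in_itv/= t0.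
  rewrite mulr1.
  apply: (@le_trans _ _ (9 / (d ^+ 2 * x))).
    rewrite -(invrK (9 / _)).
    apply: (le_trans _ (expRN_le_inv _)); last first.
      by rewrite invr_gt0 divr_gt0// mulr_gt0// exprn_gt0.
    rewrite ler_expR lerN2 invf_div ler_pdivrMr//.
    have s2 : Num.sqrt t <= 2 * Num.sqrt x.
      rewrite -(ler_pXn2r (n := 2))// ?nnegrE//.
      by rewrite exprMn ht hx; lra.
    have hd : (d * x) ^+ 2 <= (t - x) ^+ 2.
      have dx : 0 < d * x by exact: mulr_gt0.
      move: h1; rewrite in_itv/= negb_and -!ltNge => /orP[h|h].
        by rewrite -[leRHS]sqrrN opprB ler_sqr ?nnegrE; lra.
      by rewrite ler_sqr ?nnegrE; lra.
    have hf : t - x = (Num.sqrt t - Num.sqrt x) * (Num.sqrt t + Num.sqrt x).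
      by rewrite -{1}ht -{1}hx; ring.
    have h9 : (Num.sqrt t + Num.sqrt x) ^+ 2 <= 9 * x.
      by rewrite -[in leRHS]hx; nra.
    rewrite -(ler_pM2r x0); apply: (@le_trans _ _ ((t - x) ^+ 2)).
      by apply: le_trans hd; rewrite exprMn expr2 mulrA.
    rewrite hf exprMn -[leRHS]mulrA; apply: ler_wpM2l => //.
    exact: sqr_ge0.
  by rewrite -addrA addrCA lerDl addr_ge0.
rewrite exponential_pdfE//.
apply: (@le_trans _ _ (expR (- (4^-1 * t)))).
  rewrite ler_expR lerN2.
  have s2 : 2 * Num.sqrt x <= Num.sqrt t.
    rewrite -(ler_pXn2r (n := 2))// ?nnegrE//.
    by rewrite exprMn ht hx; lra.
  by rewrite -[in leLHS]ht; nra.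
by rewrite mulNr mulrA divff// mul1r lerDr addr_ge0// mulr_ge0.
Qed.

(** The three terms of the pointwise bound contribute at most the interval length [2 * d * x], then
    [9 / (d ^+ 2 * x)] times [4 * x], then 4 times the total mass 1 of the exponential law of rate
    1/4. *)
Lemma integral_expRN_sqrt_sub_le (R : realType) (d x : R) : 0 < d -> 0 < x ->
  (\int[lebesgue_measure]_(t in `[0%R, +oo[)
      (expR (- (Num.sqrt t - Num.sqrt x) ^+ 2))%:E <=
   (2 * d * x + 36 / d ^+ 2 + 4)%:E)%E.
Proof.
move=> d0 x0; have q0 : 0 <= 9 / (d ^+ 2 * x) :> R.
  by rewrite divr_ge0// mulr_ge0// ?ltW// exprn_gt0.
have dx : 0 < d * x by exact: mulr_gt0.
have mI A (i : interval R) : measurable_fun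
    (T := g_sigma_algebraType R.-ocitv.-measurable) A (\1_[set` i] : _ -> R).
  exact: measurable_funTS.
have mp A : measurable_fun (T := g_sigma_algebraType R.-ocitv.-measurable) A
    (exponential_pdf (4^-1 : R)).
  by apply: measurable_funTS; exact: measurable_exponential_pdf.
have i0 (A : set R) t : 0 <= \1_A t :> R by rewrite indicE.
have p0 t : 0 <= exponential_pdf 4^-1 t :> R by rewrite exponential_pdf_ge0.
apply: (@le_trans _ _ (\int[lebesgue_measure]_(t in `[0%R, +oo[)
   ((\1_(`[(x - d * x)%R, (x + d * x)%R]) t)%:E +
    (9 / (d ^+ 2 * x))%:E * (\1_(`[0%R, (4 * x)%R]) t)%:E
    + 4%:E * (exponential_pdf 4^-1 t)%:E))%E).
  apply: ge0_le_integral => //=.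
  - apply/measurable_EFinP; apply: measurableT_comp => //.
    apply: measurableT_comp => //; apply/measurable_funX/measurable_funB => //.
    by apply: measurable_funTS; apply: continuous_measurable_fun; exact: sqrt_continuous.
  - apply: emeasurable_funD; first apply: emeasurable_funD.
    + by apply/measurable_EFinP; exact: mI.
    + by apply: emeasurable_funM => //; apply/measurable_EFinP; exact: mI.
    + by apply: emeasurable_funM => //; apply/measurable_EFinP; exact: mp.
  - move=> t; rewrite in_itv/= andbT => t0.
    by rewrite -!EFinM -!EFinD lee_fin expRN_sqrt_sub_le.
rewrite ge0_integralD//=; first last.
- by apply: emeasurable_funM => //; apply/measurable_EFinP; exact: mp.
- by move=> t _; rewrite -EFinM lee_fin mulr_ge0.
- apply: emeasurable_funD; first by apply/measurable_EFinP; exact: mI.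
  by apply: emeasurable_funM => //; apply/measurable_EFinP; exact: mI.
- by move=> t _; rewrite -EFinM -EFinD lee_fin addr_ge0// mulr_ge0.
rewrite (EFinD (_ + _)) (EFinD (2 * d * x)); apply: leeD; last first.
  rewrite ge0_integralZl//=; last 2 first.
  - by apply/measurable_EFinP; exact: mp.
  - by move=> t _; rewrite lee_fin.
  rewrite -[leRHS]mule1; apply: lee_wpmul2l => //.
  rewrite -(@integral_exponential_pdf R 4^-1)//; apply: ge0_subset_integral => //=.
  - by apply/measurable_EFinP; exact: mp.
  - by move=> t _; rewrite lee_fin.
rewrite ge0_integralD//=; first last.
- by apply: emeasurable_funM => //; apply/measurable_EFinP; exact: mI.
- by move=> t _; rewrite -EFinM lee_fin mulr_ge0.
- by apply/measurable_EFinP; exact: mI.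
have le_itv (a b : R) : a < b -> (\int[lebesgue_measure]_(t in `[0%R, +oo[)
    (\1_(`[a, b]) t)%:E <= (b - a)%:E)%E.
  move=> ab; rewrite integral_indic//.
  apply: (@le_trans _ _ (lebesgue_measure `[a, b]%classic)).
    by apply: le_measure; rewrite ?inE//; exact: measurableI.
  by rewrite lebesgue_measure_itv/= lte_fin ab EFinB.
apply: leeD.
  apply: le_trans (le_itv _ _ _) _; first by lra.
  by rewrite lee_fin; lra.
rewrite ge0_integralZl//=; last first.
  by apply/measurable_EFinP; exact: mI.
apply: le_trans (lee_wpmul2l _ (le_itv _ _ _)) _ => //; first by lra.
rewrite -EFinM lee_fin subr0 le_eqVlt; apply/orP; left; apply/eqP.
by field; rewrite !gt_eqF.
Qed.

(** As [d] is free, taking it small makes the upper bound a small multiple of [x (x / e)^x] for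
    large [x]. Positivity allows division by [real_fact] in [ball_volume]. *)
Lemma real_fact_bounds (R : realType) (d x : R) : 0 < d -> 0 < x ->
  0 < real_fact x <= expR (x * ln x - x) * (2 * d * x + 36 / d ^+ 2 + 4).
Proof.
move=> d0 x0.
have mf A : measurable_fun (T := g_sigma_algebraType R.-ocitv.-measurable) A
    (fun t : R => t `^ x * expR (- t)).
  apply: measurable_funTS; apply: measurable_funM; first exact: measurable_powR.
  by apply: measurableT_comp => //; exact: measurableT_comp.
have f0 t : 0 <= t `^ x * expR (- t) by rewrite mulr_ge0 ?powR_ge0 ?expR_ge0.
have ub : (\int[lebesgue_measure]_(t in `[0%R, +oo[) (t `^ x * expR (- t))%:E <=
    (expR (x * ln x - x) * (2 * d * x + 36 / d ^+ 2 + 4))%:E)%E.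
  rewrite EFinM; apply: (le_trans _ (lee_wpmul2l _ (integral_expRN_sqrt_sub_le d0 x0))).
    have mg A : measurable_fun (T := g_sigma_algebraType R.-ocitv.-measurable) A
        (fun t : R => expR (- (Num.sqrt t - Num.sqrt x) ^+ 2)).
      apply: measurable_funTS; apply: measurableT_comp => //.
      apply: measurableT_comp => //; apply/measurable_funX/measurable_funB => //.
      by apply: continuous_measurable_fun; exact: sqrt_continuous.
    rewrite -ge0_integralZl//=.
    + apply: ge0_le_integral => //=.
      * by move=> t _; rewrite lee_fin.
      * by apply/measurable_EFinP; exact: mf.
      * by apply: emeasurable_funM => //; apply/measurable_EFinP; exact: mg.
      * move=> t; rewrite in_itv/= andbT => t0.
        by rewrite -EFinM lee_fin powR_expRN_le.
    + by apply/measurable_EFinP; exact: mg.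
    + by rewrite lee_fin expR_ge0.
(* Already the part over [[1, 2]] suffices: there [t^x >= 1] and [e^-t >= e^-2]. *)
have lb : ((expR (- 2))%:E <=
    \int[lebesgue_measure]_(t in `[0%R, +oo[) (t `^ x * expR (- t))%:E)%E.
  apply: (@le_trans _ _ (\int[lebesgue_measure]_(t in `[1%R, 2%R])
    (t `^ x * expR (- t))%:E)%E).
    have -> : (expR (- 2))%:E =
        (\int[lebesgue_measure]_(t in `[1%R, 2%R]) (cst (expR (- (2 : R)))%:E) t)%E.
      rewrite integral_cst//= lebesgue_measure_itv/= lte_fin ltr1n -EFinB -EFinM.
      by congr EFin; rewrite [X in _ * X](_ : _ = 1) ?mulr1//; lra.
    apply: ge0_le_integral => //=.
    - by apply/measurable_EFinP; exact: mf.
    - move=> t; rewrite in_itv/= => /andP[t1 t2].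
      rewrite lee_fin -[leLHS]mul1r ler_pM// ?expR_ge0 ?ler_expR ?lerN2//.
      by rewrite -(powRr0 t) ler_powR// ltW.
  apply: ge0_subset_integral => //=.
  - by apply/measurable_EFinP; exact: mf.
  - by move=> t _; rewrite lee_fin.
  - by move=> t /=; rewrite !in_itv/= andbT => /andP[t1 _]; rewrite (le_trans _ t1).
(* [real_fact] is [fine] of this integral, which would be 0 at infinity, so the bounds carry over
   only once finiteness is known. *)
have fin : (\int[lebesgue_measure]_(t in `[0%R, +oo[) (t `^ x * expR (- t))%:E)%E
    \is a fin_num.
  rewrite ge0_fin_numE; first exact: le_lt_trans ub (ltry _).
  by apply: le_trans lb; rewrite lee_fin expR_ge0.
rewrite /real_fact /Rintegral -lee_fin -lte_fin fineK// ub andbT.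
by apply: lt_le_trans lb; rewrite lte_fin expR_gt0.
Qed.

(** * Gaussian sums *)

(** The Gaussian decreases on the half-line, so its right-endpoint Riemann sum of mesh [s] lies
    below the integral. *)
Lemma sum_gauss_le_integral (R : realType) (s : R) (n : nat) : 0 < s ->
  ((\sum_(k < n) s * expR (- (s * k.+1%:R) ^+ 2))%:E <=
   \int[lebesgue_measure]_(x in `[0%R, (s * n%:R)%R]) (gauss_fun x)%:E)%E.
Proof.
move=> s0; elim: n => [|n IH].
  by rewrite big_ord0 integral_ge0// => x _; rewrite lee_fin gauss_fun_ge0.
have sn : 0 <= s * n%:R by rewrite mulr_ge0// ltW.
have snS : s * n%:R < s * n.+1%:R by rewrite ltr_pM2l// ltr_nat.
have -> : `[0, s * n.+1%:R]%classic =
    `[0, s * n%:R]%classic `|` `]s * n%:R, s * n.+1%:R]%classic.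
  by rewrite -itv_bndbnd_setU// bnd_simp// ltW.
rewrite ge0_integral_setU//=; first last.
- by rewrite /disj_set; apply/eqP; rewrite -subset0 => x [] /=;
    rewrite !in_itv/= => /andP[_ h1] /andP[h2 _]; have := lt_le_trans h2 h1; rewrite ltxx.
- by move=> x _; rewrite lee_fin gauss_fun_ge0.
- by apply/measurable_EFinP/measurable_funTS; exact: measurable_gauss_fun.
rewrite big_ord_recr/= EFinD leeD//.
have -> : (s * expR (- (s * n.+1%:R) ^+ 2))%:E =
   (\int[lebesgue_measure]_(x in `](s * n%:R)%R, (s * n.+1%:R)%R])
     (cst (expR (- (s * n.+1%:R) ^+ 2))%R%:E) x)%E.
  rewrite integral_cst//= lebesgue_measure_itv/= lte_fin snS -EFinB -EFinM.
  by congr EFin; rewrite mulrC; congr (_ * _); rewrite -mulrBr -natr1; ring.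
apply: ge0_le_integral => //=.
- by apply/measurable_EFinP/measurable_funTS; exact: measurable_gauss_fun.
- move=> x; rewrite in_itv/= => /andP[x1 x2].
  rewrite lee_fin ler_expR lerN2 lerXn2r// nnegrE ?(le_trans sn (ltW x1))//.
  by rewrite (le_trans sn)// ltW.
Qed.

(** The left side is the sum of [e^(-b k^2)] over all integers [|k| <= n]. The bound is the Riemann
    sum estimate with mesh [sqrt b], the Gaussian integral over the half-line being
    [sqrt pi / 2]. *)
Lemma sum_gauss_le (R : realType) (b : R) (n : nat) : 0 < b ->
  1 + 2 * \sum_(k < n) expR (- (b * k.+1%:R ^+ 2)) <= 1 + Num.sqrt (pi / b).
Proof.
move=> b0; have s0 : 0 < Num.sqrt b by rewrite sqrtr_gt0.
rewrite lerD2l -ler_pdivlMl// mulrC -(ler_pM2l s0).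
rewrite sqrtrM ?pi_ge0// sqrtrV ?(ltW b0)//.
have -> : Num.sqrt b * (Num.sqrt pi / Num.sqrt b / 2) = Num.sqrt pi / 2 :> R.
  by field; exact: lt0r_neq0.
rewrite -lee_fin mulr_sumr -integral0y_gauss.
have := @sum_gauss_le_integral R _ n s0.
under eq_bigr do rewrite exprMn sqr_sqrtr ?(ltW b0)//.
move/le_trans; apply; apply: ge0_subset_integral => //=.
- by apply/measurable_EFinP/measurable_funTS; exact: measurable_gauss_fun.
- by move=> x _; rewrite lee_fin gauss_fun_ge0.
- by move=> x /=; rewrite !in_itv/= => /andP[->].
Qed.

(** * Successive minima *)

(** Finite recursion in which each choice is constrained by the earlier ones only. It serves both
    for orthonormal bases and for successive minima. *)
Lemma greedy_choice (T : Type) (P : nat -> (nat -> T) -> T -> Prop) (n : nat) :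
  T ->
  (forall k f g t, (forall j, (j < k)%N -> f j = g j) -> P k f t -> P k g t) ->
  (forall k f, (k < n)%N -> (forall j, (j < k)%N -> P j f (f j)) ->
    exists t, P k f t) ->
  exists f, forall k, (k < n)%N -> P k f (f k).
Proof.
move=> t0 ext; elim: n => [|n IH] step; first by exists (fun=> t0).
have [k f kn|f fP] := IH; first by apply: step; exact: ltnW.
have [t tP] := step n f (ltnSn n) fP.
exists (fun j => if j == n then t else f j) => k.
rewrite ltnS leq_eqVlt => /predU1P[->|kn]; rewrite ?eqxx ?(ltn_eqF kn).
  by apply: ext tP => j jn; rewrite ltn_eqF.
by apply: ext (fP _ kn) => j jk; rewrite ltn_eqF// (ltn_trans jk).
Qed.

(** The [f j] fill the first [k] rows of a square matrix whose row [k] is zero, so the matrix is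
    singular and [q] can be taken in its kernel. *)
Lemma ex_orthogonal (F : fieldType) (n k : nat) (f : nat -> 'rV[F]_n) :
  (k < n)%N ->
  exists2 q : 'cV[F]_n, q != 0 & forall j, (j < k)%N -> f j *m q = 0.
Proof.
move=> kn; pose M : 'M[F]_n := \matrix_(i < n) (if (i < k)%N then f i else 0).
have /det0P[v v0 vM] : \det M^T == 0.
  rewrite det_tr; apply/det0P; exists (delta_mx 0 (Ordinal kn)).
    apply/eqP => /rowP/(_ (Ordinal kn)); rewrite !mxE !eqxx/=.
    by move/eqP; rewrite oner_eq0.
  by rewrite -rowE rowK ltnn.
exists v^T; first by rewrite -trmx0 (inj_eq trmx_inj).
move=> j jk; pose i := Ordinal (ltn_trans jk kn).
have -> : f j = row i M by rewrite rowK jk.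
by rewrite -row_mul -[M]trmxK -trmx_mul vM trmx0 row0.
Qed.

Lemma sqnormE (R : realType) (n : nat) (x : 'rV[R]_n) :
  x *m x^T = (sqnorm x)%:M.
Proof.
apply/matrixP => i j; rewrite !ord1 !mxE mulr1n.
by apply: eq_bigr => k _; rewrite !mxE expr2.
Qed.

Lemma sqnorm_eq0 (R : realType) (n : nat) (x : 'rV[R]_n) :
  (sqnorm x == 0) = (x == 0).
Proof.
apply/eqP/eqP => [|->]; last by rewrite /sqnorm big1// => i _; rewrite mxE expr0n.
move/psumr_eq0P => h; apply/rowP => i; apply/eqP.
by rewrite mxE -sqrf_eq0 h// => j _; exact: sqr_ge0.
Qed.

(** Gram-Schmidt, building [Q] from its last row upwards: [f k] becomes row [n - k], a unit vector
    orthogonal to the rows already built and to the rows of [X] of index below [n - k]. *)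
Lemma orthogonal_triangularization (R : realType) (n : nat) (X : 'M[R]_n) :
  exists2 Q : 'M[R]_n, Q *m Q^T = 1%:M & is_trig_mx (X *m Q^T).
Proof.
case: n X => [|n] X.
  by exists 1%:M; [rewrite trmx1 mulmx1|apply/is_trig_mxP => -[]].
pose P k (f : nat -> 'rV[R]_n.+1) (t : 'rV[R]_n.+1) := [/\ t *m t^T = 1%:M,
  forall j, (j < k)%N -> f j *m t^T = 0 &
  forall i : 'I_n.+1, (i + k < n)%N -> row i X *m t^T = 0].
have [|k f g t fg [t1 tf tX]|k f kn _|f fP] := @greedy_choice _ P n.+1.
- exact: 0.
- by split => // j jk; rewrite -fg//; exact: tf.
(* There are [k] conditions from earlier vectors and [n - k] from rows of [X], hence [n] in
   dimension [n + 1]. Index [c >= k] encodes row [c - k] of [X]. *)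
- have [q q0 qP] := @ex_orthogonal R _ n
    (fun c => if (c < k)%N then f c else row (inord (c - k)) X) (ltnSn n).
  have s0 : 0 < sqnorm q^T.
    rewrite lt_neqAle eq_sym sqnorm_eq0 -trmx0 (inj_eq trmx_inj) q0/=.
    by apply: sumr_ge0 => i _; exact: sqr_ge0.
  exists ((Num.sqrt (sqnorm q^T))^-1 *: q^T); split.
  + rewrite linearZ/= -scalemxAl -scalemxAr scalerA sqnormE.
    rewrite -invfM -expr2 sqr_sqrtr ?(ltW s0)// scale_scalar_mx mulVf//.
    by rewrite gt_eqF.
  + move=> j jk; rewrite linearZ/= trmxK -scalemxAr.
    by have := qP j; rewrite jk => ->; rewrite ?scaler0// (leq_trans jk).
  + move=> i ik; rewrite linearZ/= trmxK -scalemxAr.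
    have := qP (i + k)%N ik; rewrite ltnNge leq_addl/= addnK inord_val => ->.
    by rewrite scaler0.
pose Q : 'M[R]_n.+1 := \matrix_i f (rev_ord i).
have rev i : (rev_ord i < n.+1)%N := ltn_ord (@rev_ord n.+1 i).
have QE i j : (Q *m Q^T) i j = (f (rev_ord i) *m (f (rev_ord j))^T) 0 0.
  by rewrite !mxE; apply: eq_bigr => k _; rewrite !mxE.
exists Q.
  apply/matrixP => i j; rewrite QE [RHS]mxE.
  case: (ssrnat.ltngtP i j) => [ij|ij|/val_inj ->]; last first.
  - by have [-> _ _] := fP _ (rev j); rewrite mxE !eqxx.
  - have [_ h _] := fP _ (rev j).
    have /h -> : (rev_ord i < rev_ord j)%N by rewrite /=; have := ltn_ord i; lia.
    by rewrite !mxE -val_eqE gtn_eqF.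
  - have [_ h _] := fP _ (rev i).
    have /h/(congr1 trmx) : (rev_ord j < rev_ord i)%N.
      by rewrite /=; have := ltn_ord j; lia.
    by rewrite trmx_mul trmxK trmx0 => ->; rewrite !mxE -val_eqE ltn_eqF.
apply/is_trig_mxP => i j ij.
have [_ _ /(_ i) h] := fP _ (rev j).
have /matrixP/(_ 0 0) : row i X *m (f (rev_ord j))^T = 0.
  by apply: h => /=; have := ltn_ord j; lia.
rewrite !mxE => h2; rewrite -[RHS]h2; apply: eq_bigr => k _.
by rewrite !mxE.
Qed.

Definition int_sqnorm (n : nat) (x : 'rV[int]_n) : nat :=
  (\sum_i `|x 0%R i| ^ 2)%N.

Lemma sqnorm_intr (R : realType) (n : nat) (x : 'rV[int]_n) :
  sqnorm (map_mx intr x : 'rV[R]_n) = (int_sqnorm x)%:R.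
Proof.
rewrite /sqnorm /int_sqnorm natr_sum; apply: eq_bigr => i _.
by rewrite mxE natrX natr_absz intr_norm real_normK ?num_real.
Qed.

Lemma ex_minimizer (T : Type) (A : T -> Prop) (N : T -> nat) :
  (exists s, A s) -> exists2 s, A s & forall t, A t -> (N s <= N t)%N.
Proof.
move=> [s As]; pose P k := `[< exists2 t, A t & N t = k >].
have exP : exists k, P k by exists (N s); apply/asboolP; exists s.
have [k /asboolP[t At Nt] kmin] := ex_minnP exP.
by exists t => // u Au; rewrite Nt; apply: kmin; apply/asboolP; exists u.
Qed.

(* Stands for [x] not lying in the real span of [f 0, ..., f (k - 1)]. *)
Definition separated (R : realType) (n : nat) (f : nat -> 'rV[int]_n) (k : nat)
    (x : 'rV[int]_n) : Prop :=
  exists2 q : 'cV[R]_n, map_mx intr x *m q != 0 &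
    forall j, (j < k)%N -> map_mx intr (f j) *m q = 0.

(** A nonzero [q] killing the [f j] has a nonzero coordinate, and the corresponding axis works. This
    supplies a competitor of length [p] for each successive minimum. *)
Lemma separated_axis (R : realType) (n k p : nat) (f : nat -> 'rV[int]_n) :
  (k < n)%N -> (0 < p)%N ->
  exists i, separated R f k (p%:Z *: delta_mx 0 i).
Proof.
move=> kn p0; have [q q0 qP] := @ex_orthogonal R n k (map_mx intr \o f) kn.
have /existsP[i qi] : [exists i, q i 0 != 0].
  apply: contraNT q0; rewrite negb_exists => /forallP h.
  by apply/eqP/colP => i; rewrite mxE; apply/eqP; rewrite -[_ == _]negbK.
exists i, q => //; rewrite map_mxZ map_delta_mx -scalemxAl -rowE.
apply/eqP => /matrixP/(_ 0 0); rewrite !mxE => /eqP.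
by rewrite mulf_eq0 (negbTE qi) orbF intr_eq0; lia.
Qed.

(** The bound by [p ^ 2] places the minimal vectors in the box of points over which the Gaussian
    sums are averaged. *)
Lemma successive_minima (R : realType) (n p : nat) (L : set 'rV[int]_n) :
  (0 < p)%N -> (forall i, L (p%:Z *: delta_mx 0 i)) ->
  exists X : nat -> 'rV[int]_n, forall k, (k < n)%N ->
    [/\ L (X k), separated R X k (X k), (int_sqnorm (X k) <= p ^ 2)%N &
        forall t, L t -> separated R X k t ->
          (int_sqnorm (X k) <= int_sqnorm t)%N].
Proof.
move=> p0 Lp; pose P k X x := [/\ L x, separated R X k x,
    (int_sqnorm x <= p ^ 2)%N & forall t, L t -> separated R X k t ->
      (int_sqnorm x <= int_sqnorm t)%N].
apply: (@greedy_choice _ P); first exact: 0.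
  have sep_ext k (f g : nat -> 'rV[int]_n) x : (forall j, (j < k)%N -> f j = g j) ->
      separated R f k x -> separated R g k x.
    by move=> fg [q xq fq]; exists q => // j jk; rewrite -fg// fq.
  move=> k f g x fg [Lx fx px minx]; split => //; first exact: sep_ext fx.
  move=> t Lt gt; apply: minx => //; apply: sep_ext gt => j jk.
  by rewrite fg.
move=> k f kn _; have [i fi] := separated_axis R f kn p0.
have [|x [Lx fx] minx] :=
  @ex_minimizer _ (fun x => L x /\ separated R f k x) (@int_sqnorm n).
  by exists (p%:Z *: delta_mx 0 i).
exists x; split => //; last by move=> t Lt ft; exact: minx.
apply: leq_trans (minx _ (conj (Lp i) fi)) _.
rewrite /int_sqnorm (bigD1 i)//= big1 ?addn0; first by rewrite !mxE !eqxx mulr1.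
by move=> j ji; rewrite !mxE eqxx (negbTE ji) mulr0.
Qed.

(* Rescaling the lattice so that all successive minima become equal: in the
   coordinates of an orthonormal basis adapted to the flag spanned by
   [X 0, ..., X (n - 1)], coordinate [i] is divided by the length of [X i]. *)
Lemma lattice_equalized_minima (R : realType) (n : nat) (B : 'M[int]_n.+1)
    (L := [set x | exists z : 'rV[int]_n.+1, x = z *m B])
    (X : nat -> 'rV[int]_n.+1) :
  \det B != 0 ->
  (forall k, (k < n.+1)%N -> [/\ L (X k), separated R X k (X k) &
     forall t, L t -> separated R X k t ->
       (int_sqnorm (X k) <= int_sqnorm t)%N]) ->
  exists2 L' : set 'rV[R]_n.+1, is_lattice L' &
    \prod_(i < n.+1) Num.sqrt (int_sqnorm (X i))%:R /
      (2 ^+ n.+1 * `|(\det B)%:~R|) <=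
    Num.sqrt (lattice_min L' ^+ n.+1 / (4 ^+ n.+1 * lattice_det L')).
Proof.
move=> B0 minX; pose l (i : 'I_n.+1) : R := Num.sqrt (int_sqnorm (X i))%:R.
have XN (i : 'I_n.+1) : (0 < int_sqnorm (X i))%N.
  have [_ [q xq _] _] := minX i (ltn_ord i).
  rewrite lt0n; apply: contraNneq xq => /(congr1 (GRing.natmul (1 : R))).
  by rewrite -sqnorm_intr => /eqP; rewrite sqnorm_eq0 => /eqP ->; rewrite mul0mx.
have l0 i : 0 < l i by rewrite sqrtr_gt0 ltr0n.
have l_mono (i j : 'I_n.+1) : (i <= j)%N -> l i <= l j.
  move=> ij; rewrite ler_sqrt ?ler0n// ler_nat.
  have [_ _ ] := minX i (ltn_ord i); apply.
    by have [] := minX j (ltn_ord j).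
  have [_ [q xq fq] _] := minX j (ltn_ord j); exists q => // k ki.
  by apply: fq; exact: leq_trans ij.
have [Q QQ /is_trig_mxP QX] := orthogonal_triangularization
  (\matrix_(i < n.+1) (map_mx intr (X i) : 'rV[R]_n.+1)).
pose D : 'M[R]_n.+1 := diag_mx (\row_i (l i)^-1).
pose BR : 'M[R]_n.+1 := map_mx intr B.
pose B' := BR *m Q^T *m D.
have detQ : `|\det Q| = 1.
  apply/eqP; rewrite -(@pexpr_eq1 _ _ 2)// -normrX expr2 -{2}det_tr -det_mulmx.
  by rewrite QQ det1 normr1.
have detD : \det D = (\prod_i l i)^-1.
  by rewrite det_diag -prodfV; apply: eq_bigr => i _; rewrite mxE.
have detB' : `|\det B'| = `|(\det B)%:~R| / \prod_i l i.
  rewrite !det_mulmx det_tr !normrM detQ mulr1 detD /BR det_map_mx.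
  by rewrite normfV [X in _ / X]ger0_norm// prodr_ge0// => i _; exact: ltW.
have P0 : 0 < \prod_i l i by apply: prodr_gt0.
have B'unit : B' \in unitmx.
  rewrite unitmxE unitfE -normr_eq0 detB' mulf_neq0//.
    by rewrite normr_eq0 intr_eq0.
  by rewrite invr_eq0 gt_eqF.
pose L' : set 'rV[R]_n.+1 := [set x | exists z : 'rV[int]_n.+1, x = map_mx intr z *m B'].
have LB : is_lattice_basis L' B' by [].
exists L'; first by exists B'.
have -> : lattice_det L' = \det B' ^+ 2.
  by rewrite (lattice_detE LB) det_mulmx det_tr expr2.
have min1 : 1 <= lattice_min L'.
  apply: lb_le_inf.
    exists (sqnorm (row 0 B')), (row 0 B') => //; split.
      by exists (delta_mx 0 0); rewrite map_delta_mx rowE.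
    move/eqP => /= h; have := B'unit; rewrite unitmxE unitfE => /negP; apply.
    apply/det0P; exists (delta_mx 0 0); last by rewrite -rowE; exact/eqP.
    by apply/eqP => /rowP/(_ 0); rewrite !mxE !eqxx => /eqP; rewrite oner_eq0.
  move=> _ [x [[z xz] x0] <-].
  pose u := map_mx intr z *m BR *m Q^T.
  have xE i : x 0 i = u 0 i / l i.
    by rewrite xz /B' !mulmxA -/u mul_mx_diag !mxE.
  have uN : sqnorm u = (int_sqnorm (z *m B))%:R.
    rewrite -sqnorm_intr map_mxM.
    have := sqnormE u; rewrite /u trmx_mul trmxK mulmxA.
    rewrite -[_ *m _ *m Q]mulmxA (mulmx1C QQ) mulmx1 sqnormE.
    by move=> /matrixP/(_ 0 0); rewrite !mxE !mulr1n.
  have /existsP[i0 ui0] : [exists i, u 0 i != 0].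
    apply: contra_notT x0; rewrite negb_exists => /forallP h /=.
    by apply/rowP => i; rewrite [RHS]mxE xE (eqP (negbNE (h i))) mul0r.
  (* Let [i] be the last nonzero coordinate of [u]. Row [i] of [Q] kills [X 0, ..., X (i - 1)] but
     not [u], so [u] is at least as long as [X i]. Its nonzero coordinates are divided by
     [l j <= l i], so the rescaled vector has length at least 1. *)
  pose i := [arg max_(i > i0 | u 0%R i != 0%R) (i : nat)]%N.
  have [ui maxi] : u 0 i != 0 /\ forall j, u 0 j != 0 -> (j <= i)%N.
    by rewrite /i; case: arg_maxnP.
  have zi : (int_sqnorm (X i) <= int_sqnorm (z *m B))%N.
    have [_ _] := minX i (ltn_ord i); apply; first by exists z.
    exists (row i Q)^T.
      apply: contraNneq ui; rewrite map_mxM -/BR => h.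
      have -> : u 0 i = (map_mx intr z *m BR *m (row i Q)^T) 0 0.
        by rewrite /u !mxE; apply: eq_bigr => k _; rewrite !mxE.
      by rewrite h mxE.
    move=> j ji; have := QX (Ordinal (ltn_trans ji (ltn_ord i))) i ji => h.
    apply/matrixP => a b; rewrite !ord1 [RHS]mxE -[RHS]h !mxE.
    by apply: eq_bigr => k _; rewrite !mxE.
  have : sqnorm u / l i ^+ 2 <= sqnorm x.
    rewrite /sqnorm mulr_suml; apply: ler_sum => j _; rewrite xE expr_div_n.
    have [->|uj] := eqVneq (u 0 j) 0; first by rewrite expr0n !mul0r.
    apply: ler_wpM2l; first exact: sqr_ge0.
    rewrite lef_pV2 ?posrE ?exprn_gt0// lerXn2r ?nnegrE ?(ltW (l0 _))//.
    by rewrite l_mono// maxi.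
  apply: le_trans; rewrite uN sqr_sqrtr ?ler0n//.
  by rewrite ler_pdivlMr ?ltr0n// mul1r ler_nat.
rewrite -[leLHS]ger0_norm; last first.
  by rewrite divr_ge0 ?mulr_ge0// ltW.
rewrite -sqrtr_sqr ler_sqrt; last first.
  apply: divr_ge0; first exact: (exprn_ge0 _ (le_trans ler01 min1)).
  by apply: mulr_ge0; [exact: exprn_ge0|exact: sqr_ge0].
rewrite -[X in (X / _) ^+ 2 <= _]/(\prod_i l i).
rewrite -[\det B' ^+ 2]real_normK ?num_real// detB'.
rewrite [leLHS](_ : _ = 1 / (4 ^+ n.+1 * (`|(\det B)%:~R| / \prod_i l i) ^+ 2)).
  apply: ler_pM => //; last exact: exprn_ege1.
  by rewrite invr_ge0; apply: mulr_ge0; [exact: exprn_ge0|exact: sqr_ge0].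
have -> : 4 = 2 ^+ 2 :> R by rewrite expr2 -natrM.
rewrite -exprM mulnC exprM; field.
rewrite !gt_eqF ?exprn_gt0//=.
by rewrite normr_gt0 intr_eq0.
Qed.

(** * Averaging over lattices *)

(* Basis of the lattice of the [x] congruent to [x_0 (1, a)] modulo [p]. *)
Definition code_mx (p n : nat) (a : {ffun 'I_n -> 'I_p}) : 'M[int]_(1 + n) :=
  block_mx 1%:M (\row_i (a i)%:Z) 0 (p%:Z)%:M.

Lemma det_code_mx (p n : nat) (a : {ffun 'I_n -> 'I_p}) :
  \det (code_mx a) = (p ^ n)%:Z.
Proof. by rewrite det_ublock det1 mul1r det_scalar -natz -[RHS]natz natrX. Qed.

Lemma code_mxP (p n : nat) (a : {ffun 'I_n -> 'I_p}) (x : 'rV[int]_(1 + n)) :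
  (exists z, x = z *m code_mx a) <->
  (forall i, (p %| x 0%R (rshift 1 i) - x 0%R 0%R * (a i)%:Z)%Z).
Proof.
have x0E (y : 'rV[int]_(1 + n)) : y 0 0 = lsubmx y 0 0.
  by rewrite mxE; congr (y _ _); exact: val_inj.
split=> [[z ->] i|].
  rewrite -[z]hsubmxK mul_row_block mulmx1 mulmx0 addr0 mul_mx_scalar.
  rewrite x0E row_mxKl row_mxEr !mxE big_ord1 !mxE addrAC subrr.
  by rewrite add0r dvdz_mulr.
move=> h; exists (row_mx (lsubmx x)
  (\row_i ((x 0%R (rshift 1 i) - x 0%R 0%R * (a i)%:Z) %/ p)%Z)).
rewrite mul_row_block mulmx1 mulmx0 addr0 mul_mx_scalar -[LHS]hsubmxK; congr row_mx.
apply/rowP => i; rewrite !mxE big_ord1 !mxE.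
have := h i; rewrite dvdz_eq => /eqP.
by rewrite x0E mxE mulrC => ->; rewrite addrC subrK.
Qed.

Lemma code_mx_axis (p n : nat) (a : {ffun 'I_n -> 'I_p}) (i : 'I_(1 + n)) :
  exists z : 'rV_(1 + n), p%:Z *: delta_mx 0 i = z *m code_mx a.
Proof.
apply/code_mxP => j; rewrite !mxE.
by rewrite dvdzE -mulrA -mulrBr abszM dvdn_mulr.
Qed.

(* The integers of absolute value at most [p]: [inl i] stands for [- (i + 1)]. *)
Definition box (p : nat) : finType := ('I_p + 'I_p.+1)%type.

Definition box_val (p : nat) (k : box p) : int :=
  match k with inl i => Negz i | inr i => Posz i end.

Lemma box_valP (p : nat) (x : int) : (`|x| <= p)%N ->
  exists k : box p, box_val k = x.
Proof.
case: x => k; first by rewrite /= -ltnS => kp; exists (inr (Ordinal kp)).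
by move=> kp; exists (inl (Ordinal kp : 'I_p)).
Qed.

Lemma sum_box (R : realType) (p : nat) (w : nat -> R) :
  \sum_(k : box p) w `|box_val k|%N = w 0%N + 2 * \sum_(k < p) w k.+1.
Proof.
rewrite big_sumType/= big_ord_recl/=.
by rewrite addrCA mulr2n mulrDl mul1r.
Qed.

(** The multiples of [p] in the box are 0, [p] and [- p]. *)
Lemma sum_box_dvd (R : realType) (p : nat) (w : nat -> R) : (0 < p)%N ->
  \sum_(k : box p | (p %| box_val k)%Z) w `|box_val k|%N = w 0%N + 2 * w p.
Proof.
case: p => // p _.
have aux (F : nat -> R) : \sum_(k < p.+1 | (p.+1 %| k.+1)%N) F k.+1 = F p.+1.
  rewrite big_mkcond big_ord_recr/= dvdnn big1 ?add0r// => i _.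
  by rewrite gtnNdvd// ltnS.
rewrite big_sumType/= -(aux w).
rewrite [X in _ + X]big_mkcond big_ord_recl/=.
rewrite mulr2n mulrDl mul1r addrCA; congr (_ + (_ + _)).
by rewrite [RHS]big_mkcond.
Qed.

Section mean_value.
Variables (R : realType) (p n : nat) (w : nat -> R).
Hypotheses (p_prime : prime p) (w_ge0 : forall k, 0 <= w k).

Let point := {ffun 'I_(1 + n) -> box p}.
Let coord (f : point) : 'rV[int]_(1 + n) := \row_i box_val (f i).
Let zero : point := [ffun=> inr ord0].
Let mem (a : {ffun 'I_n -> 'I_p}) (f : point) : bool :=
  [forall i, (p %| coord f 0%R (rshift 1 i) - coord f 0%R 0%R * (a i)%:Z)%Z].
Let W (f : point) : R := \prod_i w `|box_val (f i)|%N.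

Let W_ge0 f : 0 <= W f. Proof. exact: prodr_ge0. Qed.

(** When [x_0] is invertible modulo [p], the congruences [x_i = x_0 a_i] determine every [a_i]. *)
Let card_mem (f : point) : ~~ (p %| coord f 0%R 0%R)%Z -> (#|mem^~ f| <= 1)%N.
Proof.
move=> pf; apply/card_le1_eqP => a b /forallP af /forallP bf.
apply/ffunP => i; apply/val_inj/eqP => /=.
have : (p %| coord f 0%R 0%R * ((a i)%:Z - (b i)%:Z))%Z.
  have -> : coord f 0%R 0%R * ((a i)%:Z - (b i)%:Z) =
      (coord f 0%R (rshift 1 i) - coord f 0%R 0%R * (b i)%:Z) -
      (coord f 0%R (rshift 1 i) - coord f 0%R 0%R * (a i)%:Z) by ring.
  exact: rpredB.
rewrite Gauss_dvdzr; last by rewrite coprimezE prime_coprime// -dvdzE.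
by rewrite -eqz_mod_dvd !modz_small ?ltz_nat ?ltn_ord// eqz_nat eq_sym.
Qed.

(** When [p] divides [x_0], the congruences force [p] to divide every coordinate. Such points may
    lie in all the lattices, so they are estimated separately. *)
Let mem_dvd (a : {ffun 'I_n -> 'I_p}) (f : point) :
  (p %| coord f 0%R 0%R)%Z -> mem a f -> f \in ffun_on [pred k | (p %| box_val k)%Z].
Proof.
move=> pf /forallP fP; apply/ffun_onP => i; rewrite inE.
have [j ->|->] := unliftP 0 i; last by move: pf; rewrite mxE.
have := fP j.
have -> : rshift 1 j = lift 0 j by exact: val_inj.
rewrite [X in X - _]mxE => h.
by rewrite -(subrK (coord f 0%R 0%R * (a j)%:Z) (box_val _)) rpredD// dvdz_mulr.
Qed.

Let sum_W : \sum_f W f = (w 0%N + 2 * \sum_(k < p) w k.+1) ^+ n.+1.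
Proof.
rewrite -sum_box -[in RHS](card_ord n.+1) -prodr_const.
by rewrite bigA_distr_bigA.
Qed.

Let sum_W_dvd :
  \sum_(f in ffun_on [pred k | (p %| box_val k)%Z] | f != zero) W f =
  (w 0%N + 2 * w p) ^+ n.+1 - w 0%N ^+ n.+1.
Proof.
rewrite -sum_box_dvd ?prime_gt0// -[in RHS](card_ord n.+1) -!prodr_const.
rewrite bigA_distr_big [in RHS](bigD1 zero)/=; last first.
  by apply/ffun_onP => i; rewrite ffunE unfold_in; exact: dvdz0.
rewrite [X in X + _ - _](_ : _ = \prod_(i in 'I_n.+1) w 0%N).
  by rewrite addrAC subrr add0r.
by apply: eq_bigr => i _; rewrite ffunE.
Qed.

(** Were the bound to fail for each of the [p ^ n] choices of [a], summing over [a] would contradict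
    a double count: a point with [p] not dividing [x_0] is counted at most once, giving the first
    term after division by [p ^ n], and a point of [p Z^(n+1)] at most [p ^ n] times, giving the
    second. *)
Let mean_value_code : exists a : {ffun 'I_n -> 'I_p},
  \sum_(f | mem a f && (f != zero)) W f <=
    (w 0%N + 2 * \sum_(k < p) w k.+1) ^+ n.+1 / p%:R ^+ n
    + ((w 0%N + 2 * w p) ^+ n.+1 - w 0%N ^+ n.+1).
Proof.
pose T := (w 0%N + 2 * \sum_(k < p) w k.+1) ^+ n.+1 / p%:R ^+ n
    + ((w 0%N + 2 * w p) ^+ n.+1 - w 0%N ^+ n.+1).
apply: contrapT => noa.
have pn0 : 0 < p%:R ^+ n :> R by rewrite exprn_gt0// ltr0n prime_gt0.
have : \sum_(a : {ffun 'I_n -> 'I_p}) T <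
    \sum_(a : {ffun 'I_n -> 'I_p}) \sum_(f | mem a f && (f != zero)) W f.
  apply: ltr_sum; last first.
    by move=> a _; rewrite ltNge; apply/negP => h; apply: noa; exists a.
  by apply/hasP; exists [ffun=> Ordinal (prime_gt0 p_prime)]; rewrite ?mem_index_enum.
apply/negP; rewrite -leNgt.
rewrite (exchange_big_dep (fun f => f != zero))/=; last by move=> a f _ /andP[].
rewrite sumr_const card_ffun !card_ord -[leRHS]mulr_natl natrX.
rewrite mulrDr mulrCA divff ?gt_eqF// mulr1 -sum_W -sum_W_dvd.
apply: (@le_trans _ _ (\sum_(f | f != zero) (W f +
    p%:R ^+ n * (if f \in ffun_on [pred k | (p %| box_val k)%Z] then W f else 0)))).
  apply: ler_sum => f f0; rewrite sumr_const -[leLHS]mulr_natl.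
  rewrite (eq_card (B := mem^~ f)); last by move=> a; rewrite !unfold_in f0 andbT.
  have [pf|pf] := boolP (p %| coord f 0%R 0%R)%Z; last first.
    apply: (@le_trans _ _ (W f)); last first.
      by rewrite lerDl mulr_ge0 ?(ltW pn0)//; case: ifP.
    by rewrite ler_piMl// (ler_nat _ _ 1) card_mem.
  case: ifP => [_|/negP nf].
    apply: ler_wpDl => //; apply: ler_wpM2r => //.
    rewrite -natrX ler_nat (leq_trans (max_card _))//.
    by rewrite card_ffun !card_ord.
  rewrite eq_card0 ?mul0r ?mulr0 ?addr0// => a.
  by apply/negP => /(mem_dvd pf).
rewrite big_split/= -mulr_sumr; apply: lerD.
  by rewrite [leRHS](bigD1 zero)//= lerDr.
by rewrite -big_mkcondr/= le_eqVlt; apply/orP; left; apply/eqP; congr (_ * _);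
  apply: eq_bigl => f; rewrite andbC.
Qed.

(** Distinct nonzero lattice vectors in the box contribute distinct terms to the nonnegative sum
    just bounded. *)
Lemma mean_value : exists2 B : 'M[int]_n.+1,
  \det B = (p ^ n)%:Z /\
    (forall i, exists z : 'rV_n.+1, p%:Z *: delta_mx 0 i = z *m B) &
  forall (m : nat) (X : 'I_m -> 'rV[int]_n.+1),
    injective X ->
    (forall i, [/\ exists z, X i = z *m B, X i != 0 &
       forall j, (`|X i 0%R j| <= p)%N]) ->
    \sum_(i < m) \prod_j w `|X i 0%R j|%N <=
      (w 0%N + 2 * \sum_(k < p) w k.+1) ^+ n.+1 / p%:R ^+ n
      + ((w 0%N + 2 * w p) ^+ n.+1 - w 0%N ^+ n.+1).
Proof.
have [a aP] := mean_value_code; exists (code_mx a).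
  by split; [exact: det_code_mx|exact: code_mx_axis].
move=> m X X_inj XP; apply: le_trans aP.
have /choice[g gP] i : exists f : point, coord f = X i.
  have [_ _ Xp] := XP i.
  have /choice[f fP] j : exists k : box p, box_val k = X i 0 j.
    exact: box_valP.
  by exists (finfun f); apply/rowP => j; rewrite mxE ffunE fP.
have g_inj : injective g.
  by move=> i j gij; apply: X_inj; rewrite -!gP gij.
have WE i : \prod_j w `|X i 0%R j|%N = W (g i).
  by rewrite -gP; apply: eq_bigr => j _; rewrite mxE.
under eq_bigr do rewrite WE.
rewrite -(big_imset W (h := g) (A := 'I_m))/=; last by move=> i j _ _; exact: g_inj.
rewrite big_mkcond [leRHS]big_mkcond/=; apply: ler_sum => f _.
case: ifP => [/imsetP[i _ ->]|_]; last by case: ifP.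
have [LX X0 _] := XP i; rewrite ifT//; apply/andP; split.
  by apply/forallP => j; rewrite gP; move/code_mxP: LX; apply.
apply: contraNneq X0 => gi; rewrite -gP gi; apply/eqP/rowP => j.
by rewrite !mxE ffunE.
Qed.
End mean_value.

(** * Choice of parameters *)

(** For [d = c - v > 0] one has [ln (c / v) <= d / v], and [d (d + v) <= 4 (1 + d / 2)^2 v <= 4 e^d
    v] because [v >= 1]. *)
Lemma ln_ratio_le (R : realType) (c v : R) : 0 < c -> 1 <= v ->
  ln (c / v) <= 4 * expR (c - v) / c.
Proof.
move=> c0 v1; have v0 : 0 < v by rewrite (lt_le_trans ltr01).
have [cv|vc] := lerP c v.
  apply: (@le_trans _ _ 0).
    by apply: ln_le0; rewrite ler_pdivrMr// mul1r.
  by rewrite divr_ge0 ?mulr_ge0 ?expR_ge0// ltW.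
have h1 : ln (c / v) <= (c - v) / v.
  have := @le_ln1Dx R (c / v - 1); rewrite addrCA subrr addr0.
  rewrite mulrBl divff ?gt_eqF//; apply.
  by rewrite ltrBrDl subrr divr_gt0.
apply: (le_trans h1); rewrite ler_pdivlMr// mulrAC ler_pdivrMr//.
set d := c - v; have d0 : 0 < d by rewrite subr_gt0.
have h2 : (1 + d / 2) ^+ 2 <= expR d.
  rewrite [in leRHS](_ : d = d / 2 + d / 2); last by field.
  rewrite expRD -expr2 lerXn2r ?nnegrE ?expR_ge0 ?expR_ge1Dx//.
  by rewrite addr_ge0// divr_ge0// ltW.
have -> : c = d + v by rewrite subrK.
apply: (@le_trans _ _ (4 * (1 + d / 2) ^+ 2 * v)); last first.
  by rewrite ler_wpM2r ?(ltW v0)// ler_wpM2l.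
nra.
Qed.

(** Summing [ln (c / v i) <= 4 e^(c - v i) / c] turns the hypothesis into a bound [4 n / c = 8] for
    the logarithm of [c^n / prod v]. *)
Lemma prod_ge_of_sum_expRN (R : realType) (n : nat) (v : 'I_n -> R)
    (c := n%:R / 2 : R) : (0 < n)%N -> (forall i, 1 <= v i) ->
  \sum_i expR (- v i) <= n%:R * expR (- c) ->
  c ^+ n * expR (- 8) <= \prod_i v i.
Proof.
move=> n0 v1 sum_v; have c0 : 0 < c by rewrite divr_gt0// ltr0n.
have v0 i : 0 < v i by rewrite (lt_le_trans ltr01).
rewrite expRN ler_pdivrMr ?expR_gt0// -ler_pdivrMl ?prodr_gt0//.
rewrite -prodfV mulrC -[n in c ^+ n]card_ord -prodr_const -big_split/=.
have cvE i : c * (v i)^-1 = expR (ln (c / v i)) by rewrite lnK// posrE divr_gt0.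
under eq_bigr do rewrite cvE.
rewrite -expR_sum ler_expR.
apply: (@le_trans _ _ (\sum_(i < n) 4 * expR (c - v i) / c)).
  by apply: ler_sum => i _; exact: ln_ratio_le.
under eq_bigr do rewrite expRD mulrAC mulrA.
rewrite -mulr_sumr; apply: (@le_trans _ _ (4 / c * expR c * (n%:R * expR (- c)))).
  by apply: ler_wpM2l => //; rewrite mulr_ge0 ?expR_ge0// divr_ge0// ltW.
rewrite mulrACA expRxMexpNx_1 mulr1 le_eqVlt; apply/orP; left; apply/eqP.
by rewrite /c; field; rewrite pnatr_eq0 -lt0n.
Qed.

(** The choice of [e] gives [n u <= d / (1 + d)], whence [(1 + u)^n <= e^(n u) <= 1 / (1 - n u) <= 1
    + d]. *)
Lemma expr1D_le (R : realType) (d : R) (n : nat) : 0 < d ->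
  exists2 e : R, 0 < e & forall u, 0 <= u <= e -> (1 + u) ^+ n <= 1 + d.
Proof.
move=> d0; have d1 : 0 < 1 + d by rewrite addr_gt0.
exists (d / (1 + d) / n.+1%:R); first by rewrite !divr_gt0// ltr0n.
move=> u /andP[u0 ue].
have h : n%:R * u <= d / (1 + d).
  rewrite ler_pdivlMr ?ltr0n// in ue.
  apply: le_trans ue; rewrite mulrC ler_wpM2l// ler_nat//.
apply: (@le_trans _ _ (expR (n%:R * u))).
  rewrite expRM_natl lerXn2r ?nnegrE ?expR_ge0 ?expR_ge1Dx//.
  by rewrite addr_ge0.
rewrite -[expR _]invrK -expRN -[leRHS]invrK lef_pV2 ?posrE ?invr_gt0 ?expR_gt0//.
apply: le_trans (expR_ge1Dx _).
apply: (@le_trans _ _ (1 - d / (1 + d))); last by rewrite lerD2l lerN2.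
rewrite le_eqVlt; apply/orP; left; apply/eqP; field.
by rewrite gt_eqF.
Qed.

(** With [x = n / 2 - 1], the estimate [1 + x^2 / 2 <= e^x] is enough from [n = 11] on. *)
Lemma expRN_half_le (R : realType) (n : nat) : (11 <= n)%N ->
  n%:R * expR (- (n%:R / 2)) <= expR (- 1) :> R.
Proof.
move=> n11; have n11R : 11 <= n%:R :> R by rewrite ler_nat.
have -> : - (n%:R / 2) = - 1 - (n%:R / 2 - 1) :> R by lra.
rewrite expRD mulrCA ler_piMr ?expR_ge0// expRN ler_pdivrMr ?expR_gt0// mul1r.
have x0 : 0 <= n%:R / 2 - 1 :> R by lra.
apply: le_trans (expR_ge1Dxn 1 x0); rewrite (_ : 2`! = 2)%N//.
move: (n%:R : R) n11R {x0} => x x11; nra.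
Qed.

Lemma prime_nat_gt (R : realType) (x : R) : exists2 p, prime p & x <= p%:R.
Proof.
have [p xp pp] := prime_above (Num.bound `|x|); exists p => //.
rewrite (le_trans (ler_norm _))// (le_trans (ltW (archi_boundP (normr_ge0 x))))//.
by rewrite ler_nat ltnW.
Qed.

(** Here [y] stands for [sqrt (pi / b)]. It grows like [p^(n / (n + 1))], so for large [p] both [y]
    and [p / y] are large: the first term is then close to [A / 4], and the second, from the points
    of [p Z^(n+1)], close to 0. Each is made at most [A / 2]. *)
Lemma exists_param (R : realType) (n : nat) (A : R) : (0 < n)%N -> 0 < A <= 1 ->
  exists p (y : R), [/\ prime p, 0 < y, y ^+ n.+1 = A * p%:R ^+ n / 4 &
    (1 + y) ^+ n.+1 / p%:R ^+ n +
    ((1 + 2 * expR (- (pi / y ^+ 2 * p%:R ^+ 2))) ^+ n.+1 - 1) <= A].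
Proof.
move=> n0 /andP[A0 A1]; have A20 : 0 < A / 2 by rewrite divr_gt0.
have [e e0 eP] := expr1D_le n.+1 A20.
pose t := 1 + e^-1; have t1 : 1 <= t by rewrite lerDl invr_ge0 ltW.
have t0 : 0 < t by rewrite (lt_le_trans ltr01).
have te : t^-1 <= e by rewrite invf_ple ?posrE// lerDr.
(* This size of [p] makes both [y ^+ n.+1] and [(p / y) ^+ n.+1] at least [t ^+ n.+1]. *)
have [p pp tp] := prime_nat_gt (t ^+ n.+1 * 4 / A).
have p1 : 1 <= p%:R :> R by rewrite ler1n prime_gt0.
have p0 : 0 < p%:R :> R by rewrite ltr0n prime_gt0.
have a0 : 0 < A * p%:R ^+ n / 4 by rewrite divr_gt0// mulr_gt0// exprn_gt0.
pose y := (A * p%:R ^+ n / 4) `^ (n.+1%:R^-1).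
have y0 : 0 < y by rewrite powR_gt0.
have yE : y ^+ n.+1 = A * p%:R ^+ n / 4.
  by rewrite -powR_mulrn ?ltW// -powRrM mulVf ?powRr1 ?ltW// pnatr_eq0.
have tA : t ^+ n.+1 <= A * p%:R / 4.
  by move: tp; rewrite ler_pdivrMr// => tp; rewrite ler_pdivlMr// mulrC; lra.
have ty : t <= y.
  rewrite -(ler_pXn2r (ltn0Sn n)) ?nnegrE ?(ltW t0) ?(ltW y0)// yE.
  apply: (le_trans tA); rewrite ler_pM2r// ler_pM2l//.
  by rewrite -[leLHS]expr1 ler_weXn2l.
have tpy : t <= p%:R / y.
  have py0 : 0 < p%:R / y by rewrite divr_gt0.
  rewrite -(ler_pXn2r (ltn0Sn n)) ?nnegrE ?(ltW t0) ?(ltW py0)//.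
  rewrite expr_div_n yE (le_trans tA)// exprSr.
  have -> : p%:R ^+ n * p%:R / (A * p%:R ^+ n / 4) = p%:R * (4 / A) :> R.
    by field; rewrite !gt_eqF// exprn_gt0.
  rewrite mulrAC mulrC ler_wpM2l ?(ltW p0)//.
  rewrite ler_pdivlMr// mulrAC ler_pdivrMr//; nra.
exists p, y; split => //.
have h1 : (1 + y) ^+ n.+1 / p%:R ^+ n <= A / 2.
  rewrite ler_pdivrMr ?exprn_gt0//.
  have -> : 1 + y = y * (1 + y^-1) by rewrite mulrDr mulr1 divff ?gt_eqF// addrC.
  rewrite exprMn yE; apply: (@le_trans _ _ (A * p%:R ^+ n / 4 * (1 + A / 2))).
    rewrite ler_wpM2l ?(ltW a0)// eP// invr_ge0 (ltW y0)/=.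
    by rewrite (le_trans _ te)// lef_pV2.
  have := exprn_gt0 n p0; move: (p%:R ^+ n) => P P0; have AP := mulr_gt0 A0 P0; nra.
have h2 : (1 + 2 * expR (- (pi / y ^+ 2 * p%:R ^+ 2))) ^+ n.+1 <= 1 + A / 2.
  apply: eP; rewrite mulr_ge0 ?expR_ge0//=; apply: le_trans te.
  have -> : pi / y ^+ 2 * p%:R ^+ 2 = pi * (p%:R / y) ^+ 2.
    by rewrite expr_div_n; field; rewrite gt_eqF.
  have z0 : 0 < pi * (p%:R / y) ^+ 2.
    by rewrite mulr_gt0 ?pi_gt0// exprn_gt0// divr_gt0.
  rewrite -ler_pdivlMl// (le_trans (expRN_le_inv z0))// -invfM.
  rewrite lef_pV2 ?posrE//; last by rewrite mulr_gt0.
  have pi2 : 2 <= pi :> R by exact: pi_ge2.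
  rewrite ler_pM// ?(ltW t0)//; move: (p%:R / y) tpy => z tz; nra.
by apply: le_trans (lerD h1 (lerB h2 (lexx 1))) _; lra.
Qed.

(** * Construction of the dense lattice and conclusion *)

Lemma coord_le_of_int_sqnorm (n p : nat) (x : 'rV[int]_n) (j : 'I_n) :
  (int_sqnorm x <= p ^ 2)%N -> (`|x 0%R j| <= p)%N.
Proof.
rewrite /int_sqnorm (bigD1 j)//= => h.
by rewrite -(@leq_exp2r _ _ 2)// (leq_trans _ h)// leq_addr.
Qed.

Lemma prod_expR_int_sqnorm (R : realType) (n : nat) (b : R) (x : 'rV[int]_n) :
  \prod_j expR (- (b * (`|x 0%R j|%N)%:R ^+ 2)) = expR (- (b * (int_sqnorm x)%:R)).
Proof.
rewrite -expR_sum sumrN /int_sqnorm natr_sum mulr_sumr.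
by congr (expR (- _)); apply: eq_bigr => j _; rewrite natrX.
Qed.

Lemma separated_neq0 (R : realType) (n k : nat) (X : nat -> 'rV[int]_n) :
  separated R X k (X k) -> X k != 0.
Proof.
by move=> [q xq _]; apply: contraNneq xq => ->; rewrite map_mx0 mul0mx.
Qed.

Lemma separated_inj (R : realType) (n : nat) (X : nat -> 'rV[int]_n) (m : nat) :
  (forall k, (k < m)%N -> separated R X k (X k)) ->
  injective (fun i : 'I_m => X i).
Proof.
move=> sepX i j Xij; apply/val_inj/eqP; rewrite /= -[_ == _]negbK neq_ltn.
have aux (k l : 'I_m) : X k = X l -> ~~ (k < l)%N.
  move=> kl; apply/negP => /[dup] ltkl.
  have [q xq fq] := sepX l (ltn_ord l).
  by move=> /fq; rewrite kl; apply/eqP.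
by rewrite negb_or !aux.
Qed.

(** The factor [pi ^ c] will cancel against the ball volume, and [expR (c * ln c - c)] is
    [(c / e)^c], to be compared with the factorial of [c]. *)
Lemma exists_dense_lattice (R : realType) (n : nat) (c := n.+1%:R / 2 : R) :
  (10 <= n)%N ->
  exists2 L : set 'rV[R]_n.+1, is_lattice L &
    expR (- 4) / 4 * n.+1%:R * expR (c * ln c - c) / pi `^ c <=
    2 ^+ n.+1 * Num.sqrt (lattice_min L ^+ n.+1 / (4 ^+ n.+1 * lattice_det L)).
Proof.
move=> n10; have n0 : (0 < n)%N by exact: leq_trans n10.
have c0 : 0 < c by rewrite divr_gt0.
pose A := n.+1%:R * expR (- c).
have A0 : 0 < A by rewrite mulr_gt0 ?expR_gt0.
have Ae : A <= expR (- 1) by exact: expRN_half_le.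
have [|p [y [pp y0 yE total]]] := @exists_param R n A n0.
  by rewrite A0 (le_trans Ae)// -expR0 ler_expR; lra.
have p0 : 0 < p%:R :> R by rewrite ltr0n prime_gt0.
(* With this [b], the one-dimensional Gaussian sum is at most [1 + y]. *)
pose b := pi / y ^+ 2; have b0 : 0 < b by rewrite divr_gt0 ?pi_gt0 ?exprn_gt0.
have [B [detB Baxis] Bsum] := @mean_value R p n (fun k => expR (- (b * k%:R ^+ 2)))
  pp (fun k => expR_ge0 _).
have [X XP] := @successive_minima R n.+1 p
  [set x | exists z : 'rV[int]_n.+1, x = z *m B] (prime_gt0 pp) Baxis.
have sumX : \sum_(i < n.+1) expR (- (b * (int_sqnorm (X i))%:R)) <= A.
  under eq_bigr do rewrite -prod_expR_int_sqnorm.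
  apply: le_trans (Bsum _ (fun i : 'I_n.+1 => X i) _ _) _.
  - by apply: (@separated_inj R) => k kn; have [] := XP k kn.
  - move=> i; have [LX sX Xp _] := XP i (ltn_ord i).
    split=> [//||j]; first exact: separated_neq0 sX.
    exact: coord_le_of_int_sqnorm.
  rewrite expr0n/= mulr0 oppr0 expR0 expr1n; apply: le_trans total.
  rewrite lerD2r ler_pM2r ?invr_gt0 ?exprn_gt0// lerXn2r ?nnegrE//.
  - by rewrite addr_ge0// mulr_ge0// sumr_ge0// => k _; exact: expR_ge0.
  - by rewrite addr_ge0// ltW.
  apply: le_trans (sum_gauss_le p b0) _; rewrite lerD2l /b invf_div mulrCA.
  by rewrite divff ?gt_eqF ?pi_gt0// mulr1 sqrtr_sqr ger0_norm// ltW.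
(* Each single term of the sum is at most [A <= e^-1], so its exponent is at least 1. *)
have v1 (i : 'I_n.+1) : 1 <= b * (int_sqnorm (X i))%:R.
  rewrite -lerN2 -ler_expR (le_trans _ Ae)// (le_trans _ sumX)//.
  by rewrite (bigD1 i)//= lerDl sumr_ge0// => k _; exact: expR_ge0.
have prodX := prod_ge_of_sum_expRN (ltn0Sn n) v1 sumX.
have [||L LL Lden] := @lattice_equalized_minima R n B X.
- rewrite detB; have : (0 < p ^ n)%N by rewrite expn_gt0 prime_gt0.
  lia.
- by move=> k kn; have [] := XP k kn.
exists L => //; rewrite -ler_pdivrMl ?exprn_gt0//; apply: le_trans Lden.
have -> : `|(\det B)%:~R| = p%:R ^+ n :> R.
  by rewrite detB -pmulrn natrX ger0_norm// exprn_ge0// ltW.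
(* The product bound involves squares: [P ^+ 2] is the product of the squared minima,
   [G ^+ 2 = c^(n+1)] and [H ^+ 2 = pi^(n+1)]. Both sides become squares, and the root is taken
   below. *)
pose P : R := \prod_(i < n.+1) Num.sqrt (int_sqnorm (X i))%:R.
pose G := expR (c * ln c); pose H : R := pi `^ c.
have P0 : 0 <= P by apply: prodr_ge0 => i _; exact: sqrtr_ge0.
have H0 : 0 < H by rewrite powR_gt0 ?pi_gt0.
have q0 : 0 < p%:R ^+ n :> R by rewrite exprn_gt0.
have c2 : c * 2 = n.+1%:R by rewrite /c divfK.
have G2 : G ^+ 2 = c ^+ n.+1.
  by rewrite -expRM_natr mulrAC c2 expRM_natl lnK.
have H2 : H ^+ 2 = pi ^+ n.+1.
  by rewrite -powR_mulrn ?powR_ge0// -powRrM c2 powR_mulrn// pi_ge0.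
have e8 : expR (- 8) = expR (- 4) ^+ 2 :> R.
  by rewrite -expRM_natr; congr expR; lra.
have PN : \prod_(i < n.+1) (b * (int_sqnorm (X i))%:R) =
    (H * P / (A * p%:R ^+ n / 4)) ^+ 2.
  rewrite big_split/= prodr_const card_ord /b expr_div_n -exprM mulnC exprM yE.
  rewrite -H2 /P [RHS]expr_div_n [(H * _) ^+ 2]exprMn -prodrXl mulrAC; congr (_ * _ / _).
  by apply: eq_bigr => i _; rewrite sqr_sqrtr.
have D0 : 0 < A * p%:R ^+ n / 4 by apply: divr_gt0 => //; exact: mulr_gt0.
have HPD : 0 <= H * P / (A * p%:R ^+ n / 4).
  by rewrite divr_ge0 ?(ltW D0)// mulr_ge0// ltW.
have Ge : 0 <= G * expR (- 4) by rewrite mulr_ge0 ?expR_ge0.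
move: prodX; rewrite -/c PN e8 -G2 -exprMn ler_sqr ?nnegrE//.
rewrite ler_pdivlMr// => h.
rewrite -/P [leRHS](_ : _ = (2 ^+ n.+1)^-1 * (P / p%:R ^+ n)); last first.
  by rewrite invfM mulrCA.
rewrite ler_pM2l ?invr_gt0 ?exprn_gt0//.
rewrite ler_pdivrMr// [leRHS]mulrAC ler_pdivlMr// expRD -/G.
rewrite -/H [leRHS]mulrC; apply: le_trans h; rewrite /A le_eqVlt.
by apply/orP; left; apply/eqP; field.
Qed.

(** The dense lattice contributes a factor linear in [n] times [(c / e)^c], whereas [real_fact c] is
    at most an arbitrarily small multiple of the same quantity, so every constant [C] is eventually
    exceeded. *)
Lemma max_density_ge (R : realType) (C : R) : exists N : nat,
  forall n : nat, (N <= n)%N -> ((C / 2 ^+ n)%:E <= max_density R n)%E.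
Proof.
pose C1 := Num.max C 1; have C10 : 0 < C1 by rewrite lt_max ltr01 orbT.
(* Once [36 / d^2 + 4 <= d (n + 1)], which [N] ensures, the factorial bound is at most
   [2 d (n + 1) (c / e)^c]; this [d] makes [C1 * 2 * d] equal to the lattice constant [e^-4 / 4]. *)
pose d : R := expR (- 4) / (8 * C1).
have d0 : 0 < d by rewrite divr_gt0 ?expR_gt0// mulr_gt0.
pose N := Num.bound ((36 / d ^+ 2 + 4) / d); exists (maxn 11 N) => -[|n].
  by rewrite geq_max.
rewrite geq_max => /andP[n11 nN].
pose c : R := n.+1%:R / 2; have c0 : 0 < c by rewrite divr_gt0.
have hN : 36 / d ^+ 2 + 4 <= d * n.+1%:R.
  rewrite [leRHS]mulrC -ler_pdivrMr//; apply: (@le_trans _ _ N%:R);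
    last by rewrite ler_nat.
  apply/ltW/archi_boundP; rewrite divr_ge0 ?(ltW d0)// addr_ge0// divr_ge0//.
  exact: sqr_ge0.
have [L LL Ld] := @exists_dense_lattice R n n11.
apply: (@le_trans _ _ (density L)%:E); last by apply: ereal_sup_ubound; exists L.
have [f0 fle] := andP (real_fact_bounds d0 c0).
rewrite lee_fin /density /ball_volume -/c ler_pdivrMr ?exprn_gt0// mulrC !mulrA.
rewrite ler_pdivlMr//.
apply: (@le_trans _ _ (C1 * real_fact c)).
  by rewrite ler_wpM2r ?(ltW f0)// le_max lexx.
have p0 : 0 < pi `^ c :> R by rewrite powR_gt0 ?pi_gt0.
rewrite ler_pdivrMr// -/c in Ld; apply: le_trans Ld.
apply: (le_trans (ler_wpM2l (ltW C10) fle)).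
have -> : 2 * d * c = d * n.+1%:R by rewrite /c; field.
have E0 := expR_gt0 (c * ln c - c); move: (expR _) E0 => E E0.
rewrite mulrCA [leRHS]mulrC ler_wpM2l ?(ltW E0)//.
apply: (@le_trans _ _ (C1 * (2 * (d * n.+1%:R)))).
  by rewrite ler_wpM2l ?(ltW C10)// [leRHS]mulr_natl mulr2n -addrA lerD2l.
rewrite le_eqVlt; apply/orP; left; apply/eqP; rewrite /d; field.
by rewrite gt_eqF.
Qed.

Theorem theorem3 (R : realType) (eps : R) (heps : 0 < eps) :
  exists N : nat, forall n : nat, (N <= n)%N ->
    (((1 - eps) /
      (2 ^+ n * limn (fun m : nat =>
         \sum_(1 <= k < m) expR (- (k%:R ^+ 2 * pi)))))%R%:E
     <= max_density R n)%E.
Proof.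
set S := limn _; have [N NP] := max_density_ge ((1 - eps) / S).
by exists N => n /NP; rewrite -mulrA -invfM [S * _]mulrC.
Qed.
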